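(* Let $\mathscr{M}=(\mathsf{M},\tau,\mathfrak{m})$ and $\mathscr{M}'=(\mathsf{M}',\tau',\mathfrak{m}')$ be bounded Lorentzian metric measure spaces and let $\iota\colon\mathrm{spt}\,q_\sharp\mathfrak{m}\cup\{i^0\}\to\mathrm{spt}\,q'_\sharp\mathfrak{m}'\cup\{i'^0\}$ be an isomorphism of $\mathscr{M}$ and $\mathscr{M}'$. Then $\iota$ is an isometry (i.e. a bijective distance-preserving map), hence a homeomorphism.
   Context: A bounded Lorentzian metric space is a pair $(\mathsf{M},\tau)$ of a nonempty set $\mathsf{M}$ and a function $\tau\colon\mathsf{M}^2\to[0,\infty)$ such that: (a) $\tau(x,y)+\tau(y,z)\le\tau(x,z)$ whenever $\tau(x,y)>0$ and $\tau(y,z)>0$; (b) there is a topology $T$ on $\mathsf{M}$ such that $\tau$ is continuous for the product topology $T^2$ and $\{\tau\ge\varepsilon\}\subset\mathsf{M}^2$ is compact for every $\varepsilon>0$; (c) for all distinct $x,y\in\mathsf{M}$ there is $z\in\mathsf{M}$ with $\tau(x,z)\ne\tau(y,z)$ or $\tau(z,x)\neq\tau(z,y)$. All topological and Borel notions on $\mathsf{M}$ refer to the coarsest topology satisfying (b), which exists and is Polish. A bounded Lorentzian metric measure space is a triple $\mathscr{M}=(\mathsf{M},\tau,\mathfrak{m})$ with $(\mathsf{M},\tau)$ a bounded Lorentzian metric space and $\mathfrak{m}$ a nontrivial locally finite Borel measure on $\mathsf{M}$ (not necessarily of full support). The spacelike boundary $i^0$ of a bounded Lorentzian metric space is the (unique,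 if it exists) point with $\tau(i^0,x)=\tau(x,i^0)=0$ for every $x$. On $\mathrm{spt}\,\mathfrak{m}$ define $x\sim y$ if $\tau(x,z)=\tau(y,z)$ and $\tau(z,x)=\tau(z,y)$ for every $z\in\mathrm{spt}\,\mathfrak{m}$. Let $q\colon\mathrm{spt}\,\mathfrak{m}\to\tilde{\mathsf{M}}$ be the quotient projection and $\tilde\tau(q(x),q(y)):=\tau(x,y)$; then $(\tilde{\mathsf{M}},\tilde\tau)$ is a bounded Lorentzian metric space (the distance quotient), and $\mathrm{spt}\,q_\sharp\mathfrak{m}=\tilde{\mathsf{M}}$, where $\sharp$ denotes push-forward. Write $\mathrm{spt}\,q_\sharp\mathfrak{m}\cup\{i^0\}$ for this space itself if it already has a spacelike boundary, and otherwise for the bounded Lorentzian metric space obtained by adjoining an abstract point $i^0$ (of zero measure) and extending $\tilde\tau$ by zero to pairs involving $i^0$. Use primes for the analogous objects of $\mathscr{M}'$. An isomorphism of $\mathscr{M}$ and $\mathscr{M}'$ is a Borel measurable map $\iota\colon\mathrm{spt}\,q_\sharp\mathfrak{m}\cup\{i^0\}\to\mathrm{spt}\,q'_\sharp\mathfrak{m}'\cup\{i'^0\}$ which is distance-preserving, i.e. $\tilde\tau(x,y)=\tilde\tau'(\iota(x),\iota(y))$ for all $x,y$, and satisfies $\iota_\sharp(q_\sharp\mathfrak{m})=q'_\sharp\mathfrak{m}'$. *)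

(* Defs.v *)
From HB Require Import structures.
From mathcomp Require Import all_boot all_order all_algebra.
From mathcomp Require Import all_classical all_reals all_analysis.

Set Implicit Arguments.
Unset Strict Implicit.
Unset Printing Implicit Defensive.

Import Order.TTheory GRing.Theory Num.Theory.
Import numFieldNormedType.Exports.

Local Open Scope classical_set_scope.
Local Open Scope ring_scope.
Local Open Scope quotient_scope.

Record topology (M : choiceType) := Topology {
  topo_open : set (set M);
  topo_openT : topo_open setT;
  topo_openI : setI_closed topo_open;
  topo_open_bigcup : forall F : set (set M),
    F `<=` topo_open -> topo_open (\bigcup_(U in F) U) }.

Definition topo_space (M : choiceType) (T : topology M) : Type := M.

Section topo_space.
Variables (M : choiceType) (T : topology M).

Lemma topo_open_bigcup_indexed (I : Type) (f : I -> set M) :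
  (forall i, topo_open T (f i)) -> topo_open T (\bigcup_i f i).
Proof.
move=> fT; have -> : \bigcup_i f i = \bigcup_(U in range f) U.
  by rewrite bigcup_image.
by apply: topo_open_bigcup => _ [i _ <-].
Qed.

HB.instance Definition _ := Choice.copy (topo_space T) M.
HB.instance Definition _ := isOpenTopological.Build (topo_space T)
  (topo_openT T) (@topo_openI _ T) topo_open_bigcup_indexed.

End topo_space.

Section lorentzian.
Variables (R : realType) (M : choiceType) (tau : M -> M -> R).

Definition admissible (T : topology M) : Prop :=
  continuous (fun p : topo_space T * topo_space T => tau p.1 p.2) /\
  forall e : R, 0 < e ->
    compact [set p : topo_space T * topo_space T | e <= tau p.1 p.2].

Record bounded_lorentzian : Prop := BoundedLorentzian {
  bl_nonempty : inhabited M;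
  bl_ge0 : forall x y, 0 <= tau x y;
  bl_triangle : forall x y z,
    0 < tau x y -> 0 < tau y z -> tau x y + tau y z <= tau x z;
  bl_topology : exists T, admissible T;
  bl_separation : forall x y, x <> y ->
    exists z, tau x z <> tau y z \/ tau z x <> tau z y }.

(* The intersection of all admissible topologies: this is the coarsest
   admissible topology as soon as there is one (coarsest_topologyE). *)
Definition coarsest_open : set (set M) :=
  [set U | forall T, admissible T -> topo_open T U].

Lemma coarsest_openT : coarsest_open setT.
Proof. by move=> T _; exact: topo_openT. Qed.

Lemma coarsest_openI : setI_closed coarsest_open.
Proof.
by move=> U V oU oV T adT; apply: topo_openI; [exact: oU|exact: oV].
Qed.

Lemma coarsest_open_bigcup (F : set (set M)) :
  F `<=` coarsest_open -> coarsest_open (\bigcup_(U in F) U).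
Proof.
by move=> oF T adT; apply: topo_open_bigcup => U FU; exact: oF.
Qed.

Definition coarsest_topology : topology M :=
  Topology coarsest_openT coarsest_openI coarsest_open_bigcup.

Lemma coarsest_topologyE (T : topology M) : admissible T ->
  (forall T', admissible T' -> topo_open T `<=` topo_open T') ->
  topo_open coarsest_topology = topo_open T.
Proof.
move=> adT minT; apply/seteqP; split=> [U|U TU T' adT']; first exact.
exact: minT TU.
Qed.

Definition spacelike_boundary (i : M) : Prop :=
  forall x, tau i x = 0 /\ tau x i = 0.

End lorentzian.

(* M with the coarsest admissible topology and its Borel sigma-algebra. The
   library only has measurable structures on pointed types; the choice of the
   point plays no role. *)
Definition lspace (R : realType) (M : pointedType) (tau : M -> M -> R) : Type :=
  topo_space (coarsest_topology tau).

Section lspace.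
Variables (R : realType) (M : pointedType) (tau : M -> M -> R).

HB.instance Definition _ := Topological.on (lspace tau).
HB.instance Definition _ := isPointed.Build (lspace tau) (point : M).
HB.instance Definition _ := Measurable.copy (lspace tau)
  (g_sigma_algebraType (@open (lspace tau))).

End lspace.

Section adjoin.
Variables (R : realType) (M : choiceType) (tau : M -> M -> R).

(* AdjI0 exists exactly when M has no spacelike boundary, so that this type is
   a copy of M otherwise. *)
Variant with_i0 :=
  | Pt of M
  | AdjI0 of ~ exists i, spacelike_boundary tau i.

HB.instance Definition _ := gen_eqMixin with_i0.
HB.instance Definition _ := gen_choiceMixin with_i0.

Definition i0 : with_i0 :=
  match pselect (exists i, spacelike_boundary tau i) with
  | left ex => Pt (projT1 (cid ex))
  | right noi => AdjI0 noi
  end.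

HB.instance Definition _ := isPointed.Build with_i0 i0.

Definition tau_i0 (u v : with_i0) : R :=
  match u, v with Pt x, Pt y => tau x y | _, _ => 0 end.

End adjoin.
Arguments Pt {R M} tau _.
Arguments AdjI0 {R M} tau _.
Arguments i0 {R M} tau.
Arguments tau_i0 {R M} tau u v.

Record lmmSpace (R : realType) := LmmSpace {
  lmm_carrier : pointedType;
  lmm_tau : lmm_carrier -> lmm_carrier -> R;
  lmm_bounded : bounded_lorentzian lmm_tau;
  lmm_measure : {measure set (lspace lmm_tau) -> \bar R};
  lmm_nontrivial : lmm_measure setT <> 0%E;
  lmm_locally_finite : forall x : lspace lmm_tau,
    exists U, [/\ open U, U x & (lmm_measure U < +oo)%E] }.

Section distance_quotient.
Variables (R : realType) (X : lmmSpace R).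
Local Notation tau := (@lmm_tau R X).
Local Notation m := (lmm_measure X).

Definition spt : set (lspace tau) :=
  [set x | forall U, open U -> U x -> (0 < m U)%E].

(* spt is coerced to the subtype {x | x \in spt}. *)
Definition dist_eq (x y : spt) : bool := `[< forall z : spt,
  tau (val x) (val z) = tau (val y) (val z) /\
  tau (val z) (val x) = tau (val z) (val y) >].

Lemma dist_eq_equiv : equiv_class_of dist_eq.
Proof.
split=> [x|x y|y x z].
- exact/asboolP.
- by apply: asbool_equiv_eq; split=> h w; have [-> ->] := h w.
- move=> /asboolP xy /asboolP yz; apply/asboolP => w.
  by have [-> ->] := xy w.
Qed.

Canonical dist_eq_equiv_rel := EquivRelPack dist_eq_equiv.

Definition dquot : choiceType := {eq_quot dist_eq_equiv_rel}.

Definition q (x : spt) : dquot := \pi_({eq_quot dist_eq_equiv_rel}) x.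

Definition dquot_tau (u v : dquot) : R :=
  tau (val (repr (u : {eq_quot dist_eq_equiv_rel})))
      (val (repr (v : {eq_quot dist_eq_equiv_rel}))).

Lemma dquot_tauE (x y : spt) :
  dquot_tau (q x) (q y) = tau (val x) (val y).
Proof.
have e (z : spt) : dist_eq (repr (\pi_({eq_quot dist_eq_equiv_rel}) z)) z.
  by apply/eqmodP; rewrite reprK.
rewrite /dquot_tau /q.
by have /asboolP/(_ (repr (\pi_({eq_quot dist_eq_equiv_rel}) y)))[-> _] := e x;
   have /asboolP/(_ x)[_ ->] := e y.
Qed.

Definition completion : Type := lspace (tau_i0 dquot_tau).

HB.instance Definition _ := Topological.on completion.
HB.instance Definition _ := Measurable.on completion.

Definition completion_tau : completion -> completion -> R := tau_i0 dquot_tau.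

(* The push-forward of m under q, viewed as a set function on the completion;
   an adjoined boundary point does not contribute. *)
Definition q_measure (A : set completion) : \bar R :=
  m [set val x | x in [set x : spt | A (Pt dquot_tau (q x))]].

End distance_quotient.

Section lmm_isomorphism.
Variables (R : realType) (X X' : lmmSpace R).

Definition distance_preserving (f : completion X -> completion X') : Prop :=
  forall x y, completion_tau x y = completion_tau (f x) (f y).

Definition lmm_isomorphism (f : completion X -> completion X') : Prop :=
  [/\ measurable_fun setT f,
      distance_preserving f &
      forall A : set (completion X'), measurable A ->
        pushforward (@q_measure R X) f A = q_measure A].

Definition lorentz_isometry (f : completion X -> completion X') : Prop :=
  bijective f /\ distance_preserving f.

End lmm_isomorphism.

Definition homeomorphism (T T' : topologicalType) (f : T -> T') : Prop :=
  continuous f /\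
  exists g : T' -> T, [/\ cancel f g, cancel g f & continuous g].

(* Main.v *)
(** The measure-theoretic input is that, near a point of the support at
    positive distance from or to some other point, the complement of the support
    is null. There compactness of the superlevel sets of tau makes the distance
    functions uniformly equicontinuous, so a compact set is totally bounded for
    the uniform distance between distance functions; as these functions separate
    points, this distance also induces the topology, and the complement of the
    support is locally a countable union of null open sets.

    Hence every set cut out by finitely many distance functions around a
    non-boundary point v of the target has positive measure, and so meets the
    range of iota. Points of the source whose images approximate v then lie in a
    compact part of the support, because they stay at a distance bounded below
    from a fixed point; iota sends any of their cluster points to a point with
    the same distances to the range as v, hence, again by approximation, to v
    itself. Consequently i0 is sent to i0. Finally, a distance-preserving
    bijection transports admissible topologies, so it is a homeomorphism for the
    coarsest ones. *)
Require Import Defs.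
From mathcomp Require Import all_boot all_order all_algebra.
From mathcomp Require Import all_classical all_reals all_analysis.

Set Implicit Arguments.
Unset Strict Implicit.
Unset Printing Implicit Defensive.

Import Order.TTheory GRing.Theory Num.Theory.
Import numFieldNormedType.Exports.

Local Open Scope classical_set_scope.
Local Open Scope ring_scope.
Local Open Scope quotient_scope.

(** * Distance functions and uniform closeness *)

Section directed_distance.
Variables (R : realType) (M : choiceType) (tau : M -> M -> R).

(** The Boolean selects the distance from or the distance to [x], so both are treated at once. *)
Definition dirdist (b : bool) (x y : M) := if b then tau x y else tau y x.

Lemma dirdistN b x y : dirdist (~~ b) x y = dirdist b y x.
Proof. by case: b. Qed.

(** Pointwise form of closeness for the uniform distance between distance functions; the supremum
    may equal [e]. *)
Definition uniformly_close (e : R) (x y : M) : Prop :=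
  forall b p, `|dirdist b x p - dirdist b y p| < e.

Lemma uniformly_close_sym e x y :
  uniformly_close e x y -> uniformly_close e y x.
Proof. by move=> xy b p; rewrite distrC. Qed.

Lemma uniformly_close_trans e x y z :
  uniformly_close (e / 2) x y -> uniformly_close (e / 2) y z ->
  uniformly_close e x z.
Proof.
move=> xy yz b p; rewrite (splitr e) -(subrKA (dirdist b y p)).
by rewrite (le_lt_trans (ler_normD _ _))// ltrD.
Qed.

Lemma dirdist_sep : (forall x y, x <> y ->
    exists z, tau x z <> tau y z \/ tau z x <> tau z y) ->
  forall x y, (forall b z, dirdist b x z = dirdist b y z) -> x = y.
Proof.
move=> sep x y xy; apply: contrapT => /sep[z [|]]; apply.
  exact: (xy true z).
exact: (xy false z).
Qed.

End directed_distance.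

(** * Consequences of compact superlevel sets *)

Section compact_superlevels.
Variables (R : realType) (S : topologicalType) (tau : S -> S -> R).
Hypothesis tau_cont : continuous (fun p : S * S => tau p.1 p.2).

Lemma dirdist_continuous b :
  continuous (fun p : S * S => dirdist tau b p.1 p.2).
Proof.
case: b => //= -[x y].
apply: (@continuous2_cvg _ S S _ _ _ snd fst tau y x).
- exact: (@tau_cont (y, x)).
- exact: cvg_snd.
- exact: cvg_fst.
Qed.

Lemma dirdist_continuousl b w : continuous (fun x : S => dirdist tau b x w).
Proof.
move=> x.
apply: (@continuous2_cvg _ S S _ _ _ id (fun=> w) (dirdist tau b) x w).
- exact: (@dirdist_continuous b (x, w)).
- exact: cvg_id.
- exact: cvg_cst.
Qed.

Lemma open_dirdist_ball b w (c e : R) :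
  open [set x : S | `|dirdist tau b x w - c| < e].
Proof.
rewrite [X in open X](_ : _ = (fun x : S => dirdist tau b x w) @^-1`
    [set r | `|r - c| < e])//.
apply: open_comp => [x _|]; first exact: dirdist_continuousl.
have -> : [set r | `|r - c| < e] = ball c e.
  by apply/seteqP; split => r; rewrite /ball/= distrC.
exact: ball_open.
Qed.

Lemma closed_dirdist_ge b w (e : R) :
  closed [set x : S | e <= dirdist tau b x w].
Proof.
rewrite [X in closed X](_ : _ = (fun x : S => dirdist tau b x w) @^-1`
    [set r | e <= r])//.
apply: preimage_closed => [x _|]; first exact: dirdist_continuousl.
exact: closed_ge.
Qed.

Hypothesis tau_compact : forall e : R, 0 < e ->
  compact [set p : S * S | e <= tau p.1 p.2].

Lemma compact_dirdist_range b (e : R) : 0 < e ->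
  compact [set x : S | exists w, e <= dirdist tau b x w].
Proof.
move=> e0; have cK := tau_compact e0.
have [E|E] : [set x : S | exists w, e <= dirdist tau b x w] =
    fst @` [set p : S * S | e <= tau p.1 p.2] \/
    [set x : S | exists w, e <= dirdist tau b x w] =
    snd @` [set p : S * S | e <= tau p.1 p.2].
- case: b; [left|right]; apply/seteqP; split => x /=.
  + by move=> [w ew]; exists (x, w).
  + by move=> [[y w] /= ew <-]; exists w.
  + by move=> [w ew]; exists (w, x).
  + by move=> [[w y] /= ew <-]; exists w.
- rewrite E; apply: continuous_compact => //; apply: continuous_subspaceT.
  by move=> [x y]; exact: cvg_fst.
- rewrite E; apply: continuous_compact => //; apply: continuous_subspaceT.
  by move=> [x y]; exact: cvg_snd.
Qed.

Lemma compact_dirdist_ge b w (e : R) : 0 < e ->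
  compact [set x : S | e <= dirdist tau b x w].
Proof.
move=> e0; refine (subclosed_compact (@closed_dirdist_ge b w e)
  (@compact_dirdist_range b e e0) _).
by move=> x ex; exists w.
Qed.

Hypothesis tau_ge0 : forall x y, 0 <= tau x y.

Lemma dirdist_ge0 b x y : 0 <= dirdist tau b x y.
Proof. by case: b; exact: tau_ge0. Qed.

(* Outside the compact set of points p that some point sees at distance at
   least e, both distances to p are smaller than e; on that set the tube lemma
   applies. *)
Lemma nbhs_uniformly_close (x : S) (e : R) : 0 < e ->
  \forall y \near x, uniformly_close tau e x y.
Proof.
move=> e0.
have near_b b : \forall y \near x,
    forall p, `|dirdist tau b x p - dirdist tau b y p| < e.
  have K := @compact_dirdist_range (~~ b) e e0.
  have := (compact_near_coveringP _).1 K S (nbhs x)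
    (fun y p => `|dirdist tau b x p - dirdist tau b y p| < e)
    (nbhs_filter x).
  have e20 : 0 < e / 2 by rewrite divr_gt0.
  have P p : [set p0 : S | exists w, e <= dirdist tau (~~ b) p0 w] p ->
      \forall p' \near p & y \near x,
      `|dirdist tau b x p' - dirdist tau b y p'| < e.
    move=> _.
    have /cvgrPdist_lt/(_ _ e20) := @dirdist_continuous b (x, p).
    move=> -[[A B]/= [Ax Bp] AB].
    exists (B, A) => //= -[p' y] /= [Bp' Ay].
    have := AB (x, p') (conj (nbhs_singleton Ax) Bp').
    have := AB (y, p') (conj Ay Bp') => /= h1 h2.
    rewrite -(subrKA (dirdist tau b x p)) (splitr e).
    by rewrite (le_lt_trans (ler_normD _ _))// ltrD// distrC.
  move=> /(_ P); apply: filterS => y /= Hy p.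
  have [ep|np] := pselect (exists w, e <= dirdist tau (~~ b) p w).
    exact: Hy.
  have small z : dirdist tau b z p < e.
    rewrite ltNge; apply/negP => h; apply: np; exists z.
    by move: h; case: (b).
  rewrite ltr_norml; apply/andP; split.
    by rewrite ltrNl opprB (le_lt_trans _ (small y))// gerBl dirdist_ge0.
  by rewrite (le_lt_trans _ (small x))// gerBl dirdist_ge0.
have := near_b true; have := near_b false.
by apply: filterS2 => y hf ht [].
Qed.

Lemma uniformly_totally_bounded (C : set S) (e : R) : compact C -> 0 < e ->
  exists E : seq S, forall x, C x ->
    exists2 c, c \in E & uniformly_close tau e c x.
Proof.
move=> cC e0.
(* Finite sequences ordered by inclusion: any sequence containing [x] is a net near [x], and
   compactness yields one sequence for all of [C]. *)
pose F : set_system (seq S) :=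
  filter_from setT (fun E : seq S => [set E' : seq S | {subset E <= E'}]).
have FF : Filter F.
  apply: filter_from_filter; first by exists [::].
  move=> E1 E2 _ _; exists (E1 ++ E2) => // E' /= E'E; split => c cE;
  by apply: E'E; rewrite mem_cat cE ?orbT.
have := (compact_near_coveringP _).1 cC _ F
  (fun E x => exists2 c, c \in E & uniformly_close tau e c x) FF.
case.
  move=> x _; exists ([set y | uniformly_close tau e x y],
                      [set E' : seq S | {subset [:: x] <= E'}]).
    split; first exact: nbhs_uniformly_close.
    by exists [:: x].
  by move=> [y E'] /= [xy xE']; exists x => //; apply: xE'; rewrite inE.
by move=> E _ /(_ E) h; exists E => x Cx; exact: h.
Qed.

Hypothesis sep : forall x y, x <> y ->
  exists z, tau x z <> tau y z \/ tau z x <> tau z y.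

(** Each point of [C] outside [V] differs from [x] by a definite amount in some distance function;
    compactness makes this amount uniform. *)
Lemma compact_uniformly_close_sub (C V : set S) (x : S) :
  compact C -> open V -> V x ->
  exists2 e, 0 < e & forall y, C y -> uniformly_close tau e x y -> V y.
Proof.
move=> cC oV Vx.
have cCV : compact (C `&` ~` V) by apply: compact_closedI; rewrite ?closedC.
have := (compact_near_coveringP _).1 cCV R (0^'+)
  (fun e y => ~ uniformly_close tau e x y) (at_right_proper_filter 0).
have P y : (C `&` ~` V) y -> \forall y' \near y & e \near 0^'+,
    ~ uniformly_close tau e x y'.
  move=> [_ Vy]; have [b [p bp]] : exists b p,
      dirdist tau b x p <> dirdist tau b y p.
    apply: contrapT => h; apply: Vy; rewrite (_ : y = x)//; apply/esym.
    apply: (dirdist_sep sep) => b p; apply: contrapT => bp; apply: h.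
    by exists b, p.
  pose d := `|dirdist tau b x p - dirdist tau b y p|.
  have d0 : 0 < d / 2.
    by rewrite divr_gt0// normr_gt0 subr_eq0; exact/eqP.
  exists ([set y' | `|dirdist tau b y' p - dirdist tau b y p| < d / 2],
          [set e : R | e < d / 2]).
    split; last exact: nbhs_right_lt.
    have /cvgrPdist_lt/(_ _ d0) := @dirdist_continuousl b p y.
    by apply: filterS => z /=; rewrite distrC.
  move=> [y' e] /= [yy' ed] /(_ b p) h.
  have : d < d; last by rewrite ltxx.
  rewrite [ltRHS](splitr d) {1}/d -(subrKA (dirdist tau b y' p)).
  by rewrite (le_lt_trans (ler_normD _ _))// ltrD// (lt_trans h).
move=> /(_ P) near_e.
have : \forall e \near 0^'+, 0 < e /\ (C `&` ~` V) `<=`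
    (fun y => ~ uniformly_close tau e x y).
  by apply: filterI => //; exact: nbhs_right_gt.
move=> /filter_ex[e [e0 he]]; exists e => // y Cy xy.
by apply: contrapT => Vy; exact: (he y).
Qed.

End compact_superlevels.

(** These sets are open in every admissible topology, hence in the coarsest one. *)
Lemma open_lspace_dirdist_ball (R : realType) (M : pointedType)
    (tau : M -> M -> R) b (w : M) (c e : R) :
  open ([set x | `|dirdist tau b x w - c| < e] : set (lspace tau)).
Proof.
by move=> T [ct _]; exact: (@open_dirdist_ball R (topo_space T) tau ct).
Qed.

Lemma open_lspace_measurable (R : realType) (M : pointedType)
  (tau : M -> M -> R) (U : set (lspace tau)) : open U -> measurable U.
Proof. by move=> oU; exact: sub_sigma_algebra. Qed.

(** * Null sets off the support *)

Section support.
Variables (R : realType) (X : lmmSpace R).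
Local Notation tau := (@lmm_tau R X).
Local Notation m := (lmm_measure X).
Local Notation L := (lspace tau).

Lemma not_sptP (x : L) :
  ~ spt x <-> exists U : set L, [/\ open U, U x & m U = 0%E].
Proof.
split=> [nx|[U [oU Ux mU0]] /(_ U oU Ux)]; last by rewrite mU0 ltxx.
apply: contrapT => h; apply: nx => U oU Ux; rewrite lt0e measure_ge0 andbT.
by apply/eqP => mU0; apply: h; exists U.
Qed.

Lemma open_sptC : open (~` spt (X := X)).
Proof.
rewrite [X in open X](_ : _ = \bigcup_(U in [set U : set L |
    open U /\ m U = 0%E]) U); last first.
  apply/seteqP; split => x.
    by move=> /not_sptP[U [oU Ux mU]]; exists U.
  by move=> [U [oU mU] Ux]; apply/not_sptP; exists U.
by apply: bigcup_open => U [].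
Qed.

Lemma measurable_spt : measurable (spt (X := X)).
Proof.
rewrite -(setCK (spt (X := X))); apply: measurableC.
by apply: open_lspace_measurable; exact: open_sptC.
Qed.

Section compact_part.
Variable T : topology (lmm_carrier X).
Hypothesis adT : admissible tau T.
Variable C : set (topo_space T).
Hypothesis cC : compact C.

(* The null open set chosen for one such point near a point c of an e/2-net
   contains all such points near c. *)
Let null_open_cover (e : R) : 0 < e -> exists N : set L,
  [/\ open N, m N = 0%E & forall x, C x ->
    (exists V : set L, [/\ open V, m V = 0%E &
      forall y, C y -> uniformly_close tau e x y -> V y]) -> N x].
Proof.
move=> e0; have e20 : 0 < e / 2 by rewrite divr_gt0.
have [E netE] := @uniformly_totally_bounded R (topo_space T) tau adT.1 adT.2
  (bl_ge0 (lmm_bounded X)) C _ cC e20.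
have [N [oN mN0 EN]] : exists N : set L, [/\ open N, m N = 0%E &
    forall c x, c \in E -> C x -> uniformly_close tau (e / 2) c x ->
    (exists V : set L, [/\ open V, m V = 0%E &
      forall y, C y -> uniformly_close tau e x y -> V y]) -> N x].
  elim: E {netE} => [|a E [N [oN mN0 EN]]].
    by exists set0; split; [exact: open0|exact: measure0|].
  have [[x [V [Cx ax oV mV0 xV]]]|na] := pselect (exists x (V : set L),
      [/\ C x, uniformly_close tau (e / 2) a x, open V, m V = 0%E &
      forall y, C y -> uniformly_close tau e x y -> V y]).
    exists (V `|` N); split.
    - exact: openU.
    - by rewrite measureU0//; exact: open_lspace_measurable.
    - move=> c y; rewrite inE => /predU1P[->|cE] Cy cy Vy; last first.
        by right; apply: EN cy Vy.
      left; apply: xV => //; apply: uniformly_close_trans cy.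
      exact: uniformly_close_sym.
  exists N; split=> // c y; rewrite inE => /predU1P[->|cE] Cy cy Vy; last first.
    exact: EN cy Vy.
  by exfalso; apply: na; case: Vy => V [oV mV yV]; exists y, V.
exists N; split=> // x Cx Vx; have [c cE cx] := netE x Cx.
exact: EN cx Vx.
Qed.

(** Every such [x] has a null open neighbourhood containing all points of [C] within some
    [n.+1%:R^-1] of [x], so one null open set for each [n] suffices. *)
Lemma compact_sptC_null : exists N : set L,
  [/\ measurable N, m N = 0%E & forall x, C x -> ~ spt (x : L) -> N x].
Proof.
have /choice[N NP] : forall n : nat, exists N : set L,
  [/\ open N, m N = 0%E & forall x, C x ->
    (exists V : set L, [/\ open V, m V = 0%E &
      forall y, C y -> uniformly_close tau n.+1%:R^-1 x y -> V y]) -> N x].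
  by move=> n; apply: null_open_cover; rewrite invr_gt0.
have mN n : measurable (N n).
  by apply: open_lspace_measurable; case: (NP n).
have mbN : measurable (\bigcup_n N n) by exact: bigcup_measurable.
exists (\bigcup_n N n); split => //.
  apply/negligibleP => //; apply: negligible_bigcup => n.
  by apply/negligibleP => //; case: (NP n).
move=> x Cx /not_sptP[V [oV Vx mV0]].
have [e e0 eV] := @compact_uniformly_close_sub R (topo_space T) tau adT.1
  (bl_separation (lmm_bounded X)) C V x cC (oV T adT) Vx.
have [n ne] : exists n : nat, n.+1%:R^-1 < e.
  by have := near_infty_natSinv_lt (PosNum e0) => /filter_ex[n]; exists n.
exists n => //; have [_ _] := NP n; apply => //; exists V; split => // y Cy xy.
by apply: eV => // b p; apply: lt_trans (xy b p) ne.
Qed.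

End compact_part.

Lemma open_spt_gt0 (x : L) (U : set L) b w :
  spt x -> open U -> U x -> 0 < dirdist tau b x w ->
  (0 < m (U `&` spt (X := X)))%E.
Proof.
move=> sx oU Ux xw; set e := dirdist tau b x w / 2.
have e0 : 0 < e by rewrite divr_gt0.
have [T adT] := bl_topology (lmm_bounded X).
have [N [mN mN0 CN]] := compact_sptC_null adT
  (@compact_dirdist_ge R (topo_space T) tau adT.1 adT.2 b w e e0).
(* On [W] the distance with respect to [w] stays above half its value at [x], so the part of [W] off
   the support lies in a compact set and is null. *)
pose W := U `&`
  ([set y | `|dirdist tau b y w - dirdist tau b x w| < e] : set L).
have oW : open W by apply: openI => //; exact: open_lspace_dirdist_ball.
have mW := open_lspace_measurable oW.
have mS := measurable_spt.
have WN : W `\` spt (X := X) `<=` N.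
  move=> y [[_ /=]]; rewrite ltr_norml => /andP[yw _] sy; apply: CN => //=.
  move: yw; rewrite ltrBrDl {1}(splitr (dirdist tau b x w)) -/e addrK.
  exact: ltW.
apply: (@lt_le_trans _ _ (m (W `&` spt (X := X)))); last first.
  apply: le_measure; rewrite ?inE; [exact: measurableI| |].
  - by apply: measurableI => //; exact: open_lspace_measurable.
  - by move=> y [[]].
have <- : m W = m (W `&` spt (X := X)).
  rewrite -[in LHS](setUIDK W (spt (X := X))) measureU0//.
  - exact: measurableI.
  - exact: measurableD.
  - by apply: (subset_measure0 _ mN WN mN0); exact: measurableD.
by apply: sx => //; split => //=; rewrite subrr normr0.
Qed.

End support.

(** * The distance quotient with its boundary point *)

Section completion.
Variables (R : realType) (X : lmmSpace R).
Local Notation tau := (@lmm_tau R X).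
Local Notation L := (lspace tau).
Local Notation Y := (completion X).
Local Notation cdist := (dirdist (@completion_tau R X)).
Local Notation pt s := (Pt (@dquot_tau R X) (q s) : Y).

Lemma completion_ptP (u : Y) : (exists s, u = pt s) \/
  (forall b z, cdist b u z = 0).
Proof.
case: u => [v|n]; last by right => -[] [].
by left; exists (repr (v : {eq_quot (dist_eq_equiv_rel X)})); rewrite /q reprK.
Qed.

Lemma completion_pt_gt0 b (u z : Y) : 0 < cdist b u z -> exists s, u = pt s.
Proof. by have [//|->] := completion_ptP u; rewrite ltxx. Qed.

Lemma cdist_pt b (s t : spt (X := X)) :
  cdist b (pt s) (pt t) = dirdist tau b (val s) (val t).
Proof. by case: b; exact: dquot_tauE. Qed.

Lemma cdist_ge0 b (u z : Y) : 0 <= cdist b u z.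
Proof.
have [[s ->]|->//] := completion_ptP u.
have [[t ->]|tz] := completion_ptP z; last by rewrite -dirdistN tz.
by rewrite cdist_pt dirdist_ge0//; exact: bl_ge0 (lmm_bounded X).
Qed.

(** Lets balls of distance functions be pulled back to open sets of [X]; the zero function accounts
    for an adjoined [p]. *)
Lemma cdist_lift b (p : Y) :
  (exists w : L, forall s : spt (X := X),
    cdist b (pt s) p = dirdist tau b (val s) w) \/
  (forall u, cdist b u p = 0).
Proof.
have [[t ->]|pz] := completion_ptP p; [left|right].
  by exists (val t) => s; exact: cdist_pt.
by move=> u; rewrite -dirdistN pz.
Qed.

(** Equal distances identify two points of the quotient; a quotient point with the distances of the
    adjoined point would be a spacelike boundary, which adjoining excludes. *)
Lemma completion_sep (u v : Y) :
  (forall b z, cdist b u z = cdist b v z) -> u = v.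
Proof.
case: u v => [u|n] [v|n'] uv.
- congr Pt; rewrite -[u]reprK -[v]reprK; apply/eqmodP/asboolP => z.
  have eqr (w : dquot X) :
      w = q (repr (w : {eq_quot (dist_eq_equiv_rel X)})) by rewrite /q reprK.
  by split; [move: (uv true (pt z))|move: (uv false (pt z))];
    rewrite {1}(eqr u) {1}(eqr v) !cdist_pt.
- case: (n'); exists u => x; split.
    exact: (uv true (Pt _ x)).
  exact: (uv false (Pt _ x)).
- case: (n); exists v => x; split; apply/esym.
    exact: (uv true (Pt _ x)).
  exact: (uv false (Pt _ x)).
- by congr AdjI0; exact: Prop_irrelevance.
Qed.

Lemma cdist_i0 b (z : Y) : cdist b (i0 (@dquot_tau R X)) z = 0.
Proof.
rewrite /i0; case: pselect => [ex|n]; last by case: b z => -[].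
case: cid => i /= ibd; case: z => [z|n]; last by case: b.
by have [] := ibd z; case: b.
Qed.

(* The second condition is stated separately because it is not shown that q is
   continuous for the coarsest topologies; sets cut out by finitely many
   distance functions satisfy both. *)
Definition saturated_open (A : set Y) : Prop :=
  open A /\ exists2 U : set L, open U & forall s, A (pt s) <-> U (val s).

Lemma saturated_openI A B :
  saturated_open A -> saturated_open B -> saturated_open (A `&` B).
Proof.
move=> [oA [U oU AU]] [oB [V oV BV]]; split; first exact: openI.
exists (U `&` V); first exact: openI.
by move=> s; split => -[/AU ? /BV ?].
Qed.

Lemma saturated_openT : saturated_open setT.
Proof. by split; [exact: openT|exists setT; [exact: openT|]]. Qed.

Lemma saturated_cdist_ball b (p : Y) (c e : R) :
  saturated_open [set u | `|cdist b u p - c| < e].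
Proof.
split; first exact: open_lspace_dirdist_ball.
have [[w pw]|pz] := cdist_lift b p.
  exists [set x | `|dirdist tau b x w - c| < e].
    exact: open_lspace_dirdist_ball.
  by move=> s /=; rewrite pw.
have [ce|ce] := pselect (`|0 - c| < e).
  by exists setT => [|s /=]; [exact: openT|rewrite pz].
by exists set0 => [|s /=]; [exact: open0|rewrite pz].
Qed.

(** The set measured is the trace on the support of an open set of [X], so [open_spt_gt0]
    applies. *)
Lemma q_measure_gt0 (A : set Y) (s : spt (X := X)) b z : saturated_open A ->
  A (pt s) -> 0 < cdist b (pt s) z -> (0 < q_measure A)%E.
Proof.
move=> [_ [U oU AU]] As sz.
have [t zt] : exists t, z = pt t.
  by apply: (@completion_pt_gt0 (~~ b) _ (pt s)); rewrite dirdistN.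
rewrite zt cdist_pt in sz.
rewrite /q_measure [X in lmm_measure _ X](_ : _ = U `&` spt (X := X)).
  by apply: open_spt_gt0 sz => //; [exact: set_valP|apply/AU].
apply/seteqP; split => [_ [t' At' <-]|x [Ux sx]].
  by split; [apply/AU|exact: set_valP].
have xs : x \in spt (X := X) by rewrite inE.
by exists (SigSub xs) => //=; apply/AU.
Qed.

Lemma q_measure0 : q_measure (set0 : set Y) = 0%E.
Proof.
rewrite /q_measure [X in lmm_measure _ X](_ : _ = set0) ?measure0//.
by apply/seteqP; split => // x [].
Qed.

End completion.

(** * Bijectivity of an isomorphism *)

Section isomorphism.
Variables (R : realType) (X X' : lmmSpace R).
Variable iota : completion X -> completion X'.
Hypothesis iotaP : lmm_isomorphism iota.
Local Notation tau := (@lmm_tau R X).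
Local Notation L := (lspace tau).
Local Notation Y := (completion X).
Local Notation Y' := (completion X').
Local Notation cdist := (dirdist (@completion_tau R X)).
Local Notation cdist' := (dirdist (@completion_tau R X')).
Local Notation pt s := (Pt (@dquot_tau R X) (q s) : Y).

Lemma iso_cdist b x y : cdist' b (iota x) (iota y) = cdist b x y.
Proof. by have [_ d _] := iotaP; case: b; rewrite /= d. Qed.

Lemma iso_inj : injective iota.
Proof.
move=> x y xy; apply: completion_sep => b z.
by rewrite -!iso_cdist xy.
Qed.

(** [A] has positive measure, but its preimage would be empty, hence null, if the range missed
    it. *)
Lemma iso_range_meets (A : set Y') v b z : saturated_open A -> A v ->
  0 < cdist' b v z -> exists u, A (iota u).
Proof.
move=> sA Av vz; have [s vs] := completion_pt_gt0 vz.
rewrite vs in Av vz; have := q_measure_gt0 sA Av vz.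
have [_ _ <-] := iotaP; last by apply: open_lspace_measurable; case: sA.
apply: contraPP => /forallNP nA; rewrite /pushforward.
rewrite [X in q_measure X](_ : _ = set0) ?q_measure0 ?ltxx//.
by apply/seteqP; split.
Qed.

Lemma iso_range_approx v b z (D : seq (bool * Y')) (e : R) :
  0 < cdist' b v z -> 0 < e ->
  exists u, forall a p, (a, p) \in D ->
    `|cdist' a (iota u) p - cdist' a v p| < e.
Proof.
move=> vz e0.
pose A := [set u : Y' | forall a p, (a, p) \in D ->
  `|cdist' a u p - cdist' a v p| < e].
have : saturated_open A; last first.
  move=> sA; apply: (iso_range_meets sA _ vz) => a p _.
  by rewrite subrr normr0.
rewrite /A {A}; elim: D => [|[a p] D IH].
  rewrite [X in saturated_open X](_ : _ = setT); first exact: saturated_openT.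
  by apply/seteqP; split.
rewrite [X in saturated_open X](_ : _ =
  [set u | `|cdist' a u p - cdist' a v p| < e] `&`
  [set u : Y' | forall a p, (a, p) \in D ->
    `|cdist' a u p - cdist' a v p| < e]).
  by apply: saturated_openI => //; exact: saturated_cdist_ball.
apply/seteqP; split => u /=.
  move=> uD; split; first by apply: uD; rewrite inE eqxx.
  by move=> a' p' pD; apply: uD; rewrite inE pD orbT.
move=> [uap uD] a' p'; rewrite inE => /predU1P[[-> ->]//|]; exact: uD.
Qed.

(* The range of iota separates points, because two points that differ at p are
   also told apart by all points near p. *)
Lemma iso_range_sep v v' :
  (forall b u, cdist' b v (iota u) = cdist' b v' (iota u)) -> v = v'.
Proof.
move=> vv'; apply: completion_sep => b p; apply: contrapT => /eqP ne.
(* One of the two different values at [p] is positive, so [p] is no boundary point and the range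
   approximates it. *)
have [w wp] : exists w, 0 < cdist' (~~ b) p w.
  move: ne; have := cdist_ge0 b v p; have := cdist_ge0 b v' p.
  rewrite !le_eqVlt => /predU1P[<-|v'p _ _]; last first.
    by exists v'; rewrite dirdistN.
  by move=> /predU1P[<-|vp _]; [rewrite eqxx|exists v; rewrite dirdistN].
set d := `|cdist' b v p - cdist' b v' p|.
have d0 : 0 < d / 2 by rewrite divr_gt0// normr_gt0 subr_eq0.
have [u uP] := iso_range_approx [:: (~~ b, v); (~~ b, v')] wp d0.
have := uP (~~ b) v; have := uP (~~ b) v'.
rewrite !inE !eqxx orbT => /(_ erefl) h' /(_ erefl) h.
rewrite !dirdistN in h h'; rewrite vv' in h.
have : d < d; last by rewrite ltxx.
rewrite [ltRHS](splitr d) {1}/d -(subrKA (cdist' b v' (iota u))).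
by rewrite (le_lt_trans (ler_normD _ _))// ltrD// distrC.
Qed.

(** Approximating [z] with tolerance [cdist' b v z] itself keeps the distance to [v] positive. *)
Lemma iso_range_dist v b z : 0 < cdist' b v z ->
  exists u, 0 < cdist' b v (iota u).
Proof.
move=> vz; have zv : 0 < cdist' (~~ b) z v by rewrite dirdistN.
have [u /(_ (~~ b) v)] := iso_range_approx [:: (~~ b, v)] zv vz.
rewrite inE eqxx !dirdistN => /(_ erefl); rewrite ltr_norml => /andP[h _].
by exists u; move: h; rewrite ltrBrDl subrr.
Qed.

(** [cdist] sees only support points, so continuity at [s] is stated for every [s'] lying at [x], of
    which there may be none. *)
Lemma nbhs_cdist (T : topology (lmm_carrier X)) (s : spt (X := X)) b (u : Y)
    (e : R) : admissible tau T -> 0 < e ->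
  \forall x \near (val s : topo_space T), forall s' : spt (X := X),
    val s' = x -> `|cdist b (pt s) u - cdist b (pt s') u| < e.
Proof.
move=> adT e0; have [[w uw]|uz] := cdist_lift b u; last first.
  by apply: filterE => x s' _; rewrite !uz subrr normr0.
have /cvgrPdist_lt/(_ _ e0) := @dirdist_continuousl R (topo_space T) tau
  adT.1 b w (val s).
by apply: filterS => x h s' s'x; rewrite !uw s'x.
Qed.

(* Points of the range approximating v lie over a compact subset of the
   support of X, and iota maps any of their cluster points to v. *)
Lemma iso_range_nonboundary v b z : 0 < cdist' b v z -> exists u, iota u = v.
Proof.
move=> vz; have [u0 vu0] := iso_range_dist vz.
set d := cdist' b v (iota u0) in vu0; have d0 : 0 < d / 2 by rewrite divr_gt0.
have [T adT] := bl_topology (lmm_bounded X).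
have far u : `|cdist' b (iota u) (iota u0) - d| < d / 2 -> d / 2 < cdist b u u0.
  rewrite iso_cdist ltr_norml => /andP[+ _].
  by rewrite ltrBrDl {1}(splitr d) addrK.
(* An index is a finite list of distance functions with a tolerance. *)
pose I : Type := (seq (bool * Y') * R)%type.
pose G (i : I) : set (topo_space T) := [set x | exists2 s : spt (X := X),
  val s = x & forall a p, (a, p) \in i.1 ->
    `|cdist' a (iota (pt s)) p - cdist' a v p| < i.2].
pose F : set_system (topo_space T) := filter_from [set i : I | 0 < i.2] G.
have G0 i : 0 < i.2 -> G i !=set0.
  (* The extra constraint at [iota u0], with tolerance at most [d / 2], keeps [u] at positive
     distance from [u0], so [u] comes from the support. *)
  move=> i0; have e0 : 0 < Num.min i.2 (d / 2) by rewrite lt_min i0.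
  have [u uP] := iso_range_approx ((b, iota u0) :: i.1) vz e0.
  have : d / 2 < cdist b u u0.
    apply: far; apply: (lt_le_trans (uP b (iota u0) _)).
      by rewrite inE eqxx.
    by rewrite ge_min lexx orbT.
  move=> /(lt_trans d0)/completion_pt_gt0[s us].
  exists (val s), s => // a p ap; rewrite -us.
  apply: (lt_le_trans (uP a p _)); first by rewrite inE ap orbT.
  by rewrite ge_min lexx.
have FF : ProperFilter F.
  apply: filter_from_proper; last by move=> i i0; exact: G0.
  apply: filter_from_filter; first by exists ([::], 1) => /=.
  move=> [D1 e1] [D2 e2] /= e10 e20.
  exists (D1 ++ D2, Num.min e1 e2); first by rewrite /= lt_min e10.
  move=> x [s sx sP]; split; exists s => // a p ap /=;
    (apply: (lt_le_trans (sP a p _)); first by rewrite mem_cat ap ?orbT);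
    by rewrite ge_min lexx ?orbT.
have [t u0t] : exists t, u0 = pt t.
  have [_ [s _ /(_ b (iota u0))]] := G0 ([:: (b, iota u0)], d / 2) d0.
  rewrite inE eqxx => /(_ erefl)/far/(lt_trans d0).
  by rewrite -dirdistN => /completion_pt_gt0.
pose C := [set x : topo_space T | d / 2 <= dirdist tau b x (val t)] `&`
  (spt (X := X) : set (topo_space T)).
have cC : compact C.
  apply: compact_closedI.
    exact: (@compact_dirdist_ge R (topo_space T) tau adT.1 adT.2).
  rewrite -[X in closed X]setCK closedC.
  exact: (@open_sptC R X T adT).
have FC : F C.
  exists ([:: (b, iota u0)], d / 2) => // _ [s <- /(_ b (iota u0))].
  rewrite inE eqxx => /(_ erefl)/far; rewrite u0t cdist_pt => /ltW h.
  by split => //; exact: set_valP.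
have [x [[_ sx] xF]] := cC F FF FC.
have xs : x \in spt (X := X) by rewrite inE.
pose s : spt (X := X) := SigSub xs.
exists (pt s); apply: iso_range_sep => a u; rewrite iso_cdist.
apply: contrapT => /eqP ne; set h := `|cdist a (pt s) u - cdist' a v (iota u)|.
have h0 : 0 < h / 2 by rewrite divr_gt0// normr_gt0 subr_eq0.
(* The cluster point supplies a [y] that approximates [v] and is close to [x], each within half of
   the gap [h]. *)
have [y [[s' s'y s'P] near_y]] : G ([:: (a, iota u)], h / 2) `&`
    [set x | forall s' : spt (X := X), val s' = x ->
      `|cdist a (pt s) u - cdist a (pt s') u| < h / 2] !=set0.
  by apply: xF; [exists ([:: (a, iota u)], h / 2)|exact: (nbhs_cdist s)].
have := s'P a (iota u); rewrite inE eqxx => /(_ erefl).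
rewrite iso_cdist /= => h1.
have : h < h; last by rewrite ltxx.
rewrite [ltRHS](splitr h) {1}/h -(subrKA (cdist a (pt s') u)).
by rewrite (le_lt_trans (ler_normD _ _))// ltrD// near_y.
Qed.

Lemma iso_surj v : exists u, iota u = v.
Proof.
have [[b [z vz]]|nb] := pselect (exists b z, 0 < cdist' b v z).
  exact: iso_range_nonboundary vz.
(* No distance of [v] is positive, so all vanish, as do those of [i0]. *)
exists (i0 (@dquot_tau R X)); apply: iso_range_sep => b u.
rewrite iso_cdist cdist_i0; apply/eqP; rewrite eq_le cdist_ge0/= leNgt.
by apply/negP => vu; apply: nb; exists b, (iota u).
Qed.

End isomorphism.

(** * Transport of admissible topologies *)

Lemma pair_map_continuous (S1 S2 : topologicalType) (f : S1 -> S2) :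
  continuous f -> continuous (fun p : S1 * S1 => (f p.1, f p.2)).
Proof.
move=> cf [x y]; apply: cvg_pair.
  by apply: continuous_comp; [exact: cvg_fst|exact: cf].
by apply: continuous_comp; [exact: cvg_snd|exact: cf].
Qed.

Section transport.
Variables (R : realType) (M1 M2 : pointedType).
Variables (tau1 : M1 -> M1 -> R) (tau2 : M2 -> M2 -> R).
Variables (f : M1 -> M2) (g : M2 -> M1).
Hypotheses (fK : cancel f g) (gK : cancel g f).
Hypothesis f_dist : forall x y, tau1 x y = tau2 (f x) (f y).

Section pushforward_topology.
Variable T : topology M1.

Let push_open : set (set M2) := [set U | topo_open T (f @^-1` U)].

Let push_openT : push_open setT. Proof. exact: topo_openT. Qed.

Let push_openI : setI_closed push_open.
Proof. by move=> U V oU oV; exact: topo_openI. Qed.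

Let push_open_bigcup (F : set (set M2)) :
  F `<=` push_open -> push_open (\bigcup_(U in F) U).
Proof.
move=> oF; rewrite /push_open/= preimage_bigcup.
rewrite -(bigcup_image F (fun U => f @^-1` U) id).
by apply: topo_open_bigcup => _ [U FU <-]; exact: oF.
Qed.

Definition push_topology : topology M2 :=
  Topology push_openT push_openI push_open_bigcup.

Local Notation S1 := (topo_space T).
Local Notation S2 := (topo_space push_topology).

Lemma push_topology_continuous : continuous (f : S1 -> S2).
Proof. by apply/continuousP => U oU; exact: oU. Qed.

Lemma push_topology_continuousV : continuous (g : S2 -> S1).
Proof.
apply/continuousP => U oU; rewrite /open/= /push_open/=.
rewrite (_ : f @^-1` (g @^-1` U) = U)//.
by apply/seteqP; split => x /=; rewrite fK.
Qed.

(** [tau2] is [tau1] composed with the continuous [g], and its superlevel sets are images under the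
    continuous [f]. *)
Lemma push_topology_admissible :
  admissible tau1 T -> admissible tau2 push_topology.
Proof.
move=> [ct kt]; split.
  rewrite [X in continuous X](_ : _ = (fun p : S1 * S1 => tau1 p.1 p.2) \o
      (fun p : S2 * S2 => (g p.1 : S1, g p.2 : S1))); last first.
    by apply/funext => -[x y] /=; rewrite f_dist !gK.
  move=> p; apply: continuous_comp; last exact: ct.
  exact: (pair_map_continuous push_topology_continuousV).
move=> e e0.
rewrite [X in compact X](_ : _ = (fun p : S1 * S1 => (f p.1 : S2, f p.2 : S2))
    @` [set p : S1 * S1 | e <= tau1 p.1 p.2]); last first.
  apply/seteqP; split => [[x y]/= exy|_ [[x y]/= exy <-]].
    by exists (g x, g y); rewrite /= ?f_dist !gK.
  by rewrite /= -f_dist.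
apply: continuous_compact; last exact: kt.
apply: continuous_subspaceT.
exact: (pair_map_continuous push_topology_continuous).
Qed.

End pushforward_topology.

(** A set open in the coarsest topology of [tau2] is open in the push-forward of every [T]
    admissible for [tau1], so its preimage is open in every such [T]. *)
Lemma lspace_isometry_continuous : continuous (f : lspace tau1 -> lspace tau2).
Proof.
apply/continuousP => U oU; change (coarsest_open tau1 (f @^-1` U)).
by move=> T adT; exact: (oU _ (push_topology_admissible adT)).
Qed.

End transport.

Theorem proposition2p19 (R : realType) (X X' : lmmSpace R)
    (iota : completion X -> completion X') :
  lmm_isomorphism iota -> lorentz_isometry iota /\ homeomorphism iota.
Proof.
move=> isoP; have [_ iota_dist _] := isoP.
have [g gK] := choice (iso_surj isoP).
have fK : cancel iota g by move=> x; apply: (iso_inj isoP); rewrite gK.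
split; first by split => //; exists g.
split; first exact: (lspace_isometry_continuous fK gK iota_dist).
exists g; split => //; apply: (lspace_isometry_continuous gK fK) => x y.
by have := iota_dist (g x) (g y); rewrite !gK => /esym.
Qed.
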